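(* Let $n$ be a positive integer. If $5 \nmid n$, then \[ \sum_{j=0}^\infty \sigma\big(2n+1-j(j+1)\big) \equiv 0 \pmod{5}. \] If $n \neq k(k+1)/2$ for every integer $k$, then \[ \sum_{j=0}^\infty \sigma\big(n-j(j+1)/2\big) \equiv 0 \pmod{4}. \]
   Context: For a positive integer $m$, $\sigma(m)$ denotes the sum of the positive divisors of $m$. By convention $\sigma(m)=0$ whenever $m$ is not a positive integer (so the sums above are finite). *)

(* Defs.v *)
From mathcomp Require Export all_boot all_order all_algebra.
From mathcomp Require Export classical_sets cardinality fsbigop.
From mathcomp Require Import zify.
Set Implicit Arguments.
Unset Strict Implicit.
Unset Printing Implicit Defensive.

(* The case split is needed: [divisors 0] is not the empty sequence. *)
Definition sigma (m : int) : nat :=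
  if (0 < m)%R then \sum_(d <- divisors `|m|) d else 0.

(* [\big[addn/0]_(j \in [set: nat]) F j] is the infinite sum of the F j when
   F has finite support, and 0 otherwise; the next lemma shows that all the
   sums considered here do have finite support, and hence the value expected. *)
Lemma fsbig_sigma (N : int) (t : nat -> nat) (B : nat) :
  (forall j, B <= j -> (N <= (t j)%:Z)%R) ->
  finite_set [set j | sigma (N - (t j)%:Z)%R <> 0] /\
  \big[addn/0]_(j \in [set: nat]) sigma (N - (t j)%:Z)%R
    = \sum_(0 <= j < B) sigma (N - (t j)%:Z)%R.
Proof.
move=> tB.
have s0 j : B <= j -> sigma (N - (t j)%:Z)%R = 0.
  by move=> /tB h; rewrite /sigma; case: ifP => //; lia.
split.
  apply: (@sub_finite_set _ _ `I_B); last exact: finite_II.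
  by move=> j /= nz; rewrite ltnNge; apply/negP => /s0.
rewrite (@fsbigE _ _ _ _ _ (index_iota 0 B)) ?iota_uniq //.
  by apply: eq_bigl => j; rewrite in_setT.
by move=> j _; rewrite mem_index_iota -leqNgt => /s0.
Qed.

(* Main.v *)
(** Write [S] for the set of integer triples [(a, x, b)] with [a, b > 0] and
    [x^2 + 4 a b = 4 M + 1]. Putting [x = 2 j + 1] turns the equation into
    [j (j + 1) + a b = M], so that the sum of [a] over [S] is twice the sum of
    the [sigma (M - j (j + 1))]. If [4 M + 1] is not a square, then [S] carries
    the Zagier-like involution sending [(a, x, b)] to
    [(a, - x - 2 a, b - x - a)] when [x < b - a] and to
    [(a + x - b, 2 b - x, b)] otherwise. Functions on [S] that are odd under
    this involution sum to zero.

    For [M = 2 n + 1] the odd function [(a + b) (x - b) (x + a)] gives, after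
    averaging over [x -> - x] and [a <-> b], [\sum a (x^2 - a b) = 0], that is
    [(8 n + 5) \sum a = 5 \sum a x^2].

    For [M = 2 n] the function equal to [a + x] if [a] is odd, to [b - x] if
    [b] is odd and to [- (a + b)] otherwise is odd, whence the sums of [a] over
    the triples with [a] odd and over those with [a] and [b] even agree. *)

Require Import Defs.
From mathcomp Require Import zify ring.
Import Order.TTheory GRing.Theory Num.Theory.

Set Implicit Arguments.
Unset Strict Implicit.
Unset Printing Implicit Defensive.

Local Open Scope ring_scope.

(** * Sums over a list stable under an involution *)

Section InvolutionSum.

Variables (T : eqType) (s : seq T) (f : T -> T).
Hypotheses (s_uniq : uniq s) (fs : forall t, t \in s -> f t \in s).
Hypothesis fK : forall t, t \in s -> f (f t) = t.

Lemma perm_map_involution : perm_eq (map f s) s.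
Proof.
have fs_uniq : uniq (map f s).
  by rewrite map_inj_in_uniq // => t u ts us e; rewrite -(fK ts) e fK.
apply: uniq_perm => // t; apply/mapP/idP => [[u us ->]|ts]; first exact: fs.
by exists (f t); rewrite ?fK ?fs.
Qed.

Lemma sum_involution (F : T -> int) :
  \sum_(t <- s) F (f t) = \sum_(t <- s) F t.
Proof. by rewrite -[RHS](perm_big _ perm_map_involution) big_map. Qed.

Lemma sum_odd_involution (F : T -> int) :
  (forall t, t \in s -> F (f t) = - F t) -> \sum_(t <- s) F t = 0.
Proof.
move=> Fodd; have := sum_involution F.
rewrite big_seq_cond (eq_bigr (fun t => - F t)); last first.
  by move=> t /andP[/Fodd].
by rewrite -big_seq_cond sumrN; set z := \sum_(t <- s) F t; lia.
Qed.

End InvolutionSum.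

(** * Positive [a], [b] and integer [x] with [x^2 + 4 a b = 4 M + 1] *)

Definition triple := (int * int * int)%type.

Definition pos_triples (M : nat) : seq triple :=
  [seq (d%:Z, (2 * j + 1)%N%:Z, ((M - j * (j + 1)) %/ d)%N%:Z)
     | j <- [seq j <- iota 0 M | j * (j + 1) < M]%N,
       d <- divisors (M - j * (j + 1))].

Definition neg_triple (t : triple) : triple := (t.1.1, - t.1.2, t.2).
Definition swap_triple (t : triple) : triple := (t.2, t.1.2, t.1.1).

Definition triples (M : nat) : seq triple :=
  pos_triples M ++ map neg_triple (pos_triples M).

Lemma mem_pos_triples M a x b :
  ((a, x, b) \in pos_triples M) =
  [&& 0 < a, 0 < b, 0 < x & x * x + 4 * (a * b) == 4 * M%:Z + 1].
Proof.
apply/allpairsPdep/and4P => [[j [d [jP dP [-> -> ->]]]]|[a0 b0 x0 /eqP e]].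
  move: jP; rewrite mem_filter mem_iota => /andP[jM _].
  have m0 : (0 < M - j * (j + 1))%N by lia.
  move: dP; rewrite -dvdn_divisors // => dM.
  have d0 : (0 < d)%N by exact: dvdn_gt0 dM.
  have q0 : (0 < (M - j * (j + 1)) %/ d)%N by rewrite divn_gt0 // dvdn_leq.
  split; [lia | lia | lia |].
  have := divnK dM; set q := (_ %/ d)%N => e.
  have e' : (M = q * d + j * (j + 1))%N by lia.
  by apply/eqP; rewrite e'; lia.
have [c xc] : exists c : nat, x = (2 * c + 1)%N%:Z.
  exists (`|x| %/ 2)%N.
  have : (odd `|x|); last by lia.
  have : odd (`|x| * `|x|) by nia.
  by rewrite oddM andbb.
subst x.
case: a a0 e => // a a0 e; case: b b0 e => // b b0 e.
have e' : (M - c * (c + 1) = a * b)%N by nia.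
have cM : (c * (c + 1) < M)%N by nia.
exists c, a; split.
- by rewrite mem_filter mem_iota cM /=; nia.
- by rewrite e' -dvdn_divisors ?muln_gt0 ?dvdn_mulr //; lia.
- by rewrite e' mulKn.
Qed.

Lemma mem_triples M a x b :
  ((a, x, b) \in triples M) =
  [&& 0 < a, 0 < b & x * x + 4 * (a * b) == 4 * M%:Z + 1].
Proof.
have -> : ((a, x, b) \in triples M) =
    ((a, x, b) \in pos_triples M) || ((a, - x, b) \in pos_triples M).
  rewrite mem_cat; congr orb.
  have nK : involutive neg_triple by case=> [[? ?] ?]; rewrite /neg_triple /= opprK.
  by rewrite -[in LHS](nK (a, x, b)) mem_map //; exact: inv_inj nK.
rewrite !mem_pos_triples mulrNN; do 2 case: ltP => //= _.
(* [x = 0] would make [4 M + 1] a multiple of 4. *)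
have [->|x0] := eqVneq x 0; first by rewrite oppr0 ltxx /=; lia.
by rewrite -andb_orl; case: eqP => _; rewrite ?andbF // andbT; lia.
Qed.

Lemma pos_triples_uniq M : uniq (pos_triples M).
Proof.
apply: allpairs_uniq_dep.
- by rewrite filter_uniq ?iota_uniq.
- by move=> j _; exact: divisors_uniq.
- move=> [j d] [k c] /= _ _ [e1 e2 _]; have ejk : j = k by lia.
  by subst k; rewrite e1.
Qed.

Lemma triples_uniq M : uniq (triples M).
Proof.
rewrite cat_uniq map_inj_uniq ?pos_triples_uniq //=; last first.
  by apply: inv_inj => -[[? ?] ?]; rewrite /neg_triple /= opprK.
rewrite andbT; apply/hasPn => _ /mapP[[[a x] b] + ->].
by rewrite /neg_triple !mem_pos_triples /= => /and4P[_ _ x0 _]; apply/negP => /and4P[]; lia.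
Qed.

Lemma sum_triples_even M (F : triple -> int) :
  (forall t, F (neg_triple t) = F t) ->
  \sum_(t <- triples M) F t = 2 * \sum_(t <- pos_triples M) F t.
Proof.
move=> Feven; rewrite big_cat big_map /= [X in _ + X](eq_bigr F) //.
by rewrite -mulr2n mulr_natl.
Qed.

Lemma sum_triples_odd M (F : triple -> int) :
  (forall t, F (neg_triple t) = - F t) -> \sum_(t <- triples M) F t = 0.
Proof.
move=> Fodd; rewrite big_cat big_map /=.
by rewrite [X in _ + X](eq_bigr (fun t => - F t)) // sumrN subrr.
Qed.

Lemma sum_triples_swap M (F : triple -> int) :
  \sum_(t <- triples M) F (swap_triple t) = \sum_(t <- triples M) F t.
Proof.
apply: sum_involution; first exact: triples_uniq.
- by case=> [[a x] b]; rewrite /swap_triple !mem_triples (mulrC b) => /and3P[-> -> ->].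
- by case=> [[]].
Qed.

(** * The Zagier-like involution and the relation behind the factor 5 *)

Definition zagier (t : triple) : triple :=
  let: (a, x, b) := t in
  if x < b - a then (a, - x - 2 * a, b - x - a) else (a + x - b, 2 * b - x, b).

Section NonSquare.

Variable M : nat.
Hypothesis nonsq : forall s : int, s * s <> 4 * M%:Z + 1.

(** On the boundary [x = b - a] between the branches of [zagier], [x^2 + 4 a b] is the square
    [(a + b)^2]. Excluding it keeps [a + x - b] positive in the second branch. *)
Lemma triples_neq a x b : (a, x, b) \in triples M -> x != b - a.
Proof.
rewrite mem_triples => /and3P[a0 b0 /eqP e]; apply/eqP => xE.
by apply: (nonsq (s := a + b)); rewrite -e xE; ring.
Qed.

Lemma zagier_triples t : t \in triples M -> zagier t \in triples M.
Proof.
case: t => [[a x] b] tS; have := triples_neq tS; move: tS => /=.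
rewrite mem_triples => /and3P[a0 b0 /eqP e] ne.
by case: ltP => le; rewrite mem_triples -e; apply/and3P; split; lia.
Qed.

(** Each branch is stable: on the image, the test [x < b - a] becomes [0 < b] in the first branch
    and [a < 0] in the second. *)
Lemma zagierK t : t \in triples M -> zagier (zagier t) = t.
Proof.
case: t => [[a x] b] tS; have := triples_neq tS; move: tS => /=.
rewrite mem_triples => /and3P[a0 b0 _] ne.
case: (ltP x) => le /=; case: ltP => le' /=; try lia.
- by congr (_, _, _); ring.
- by congr (_, _, _); ring.
Qed.

Lemma sum_zagier_odd (F : triple -> int) :
  (forall a x b, (a, x, b) \in triples M -> F (zagier (a, x, b)) = - F (a, x, b)) ->
  \sum_(t <- triples M) F t = 0.
Proof.
move=> Fodd; apply: (sum_odd_involution (triples_uniq M) zagier_triples zagierK).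
by case=> [[a x] b]; exact: Fodd.
Qed.

Lemma sum_triples_cubic :
  \sum_(t <- triples M) t.1.1 * (t.1.2 * t.1.2 - t.1.1 * t.2) = 0.
Proof.
pose G (t : triple) := t.1.1 * (t.1.2 * t.1.2 - t.1.1 * t.2).
pose K (t : triple) := t.1.2 * (t.1.1 * t.1.1 - t.2 * t.2).
(* The summand below is [(a + b) (x - b) (x + a)]. *)
have : \sum_(t <- triples M) (G t + G (swap_triple t) + K t) = 0.
  apply: sum_zagier_odd => a x b _; rewrite /zagier /G /K /swap_triple.
  (* Both branches permute [a + b], [x - b] and [x + a] up to signs of product [-1]. *)
  by case: ifP => _ /=; ring.
(* [K] is odd in [x], and both [G] terms have the same sum. *)
rewrite !big_split /= sum_triples_swap (@sum_triples_odd _ K).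
  by rewrite -/G; set z := \sum_(t <- _) _; lia.
by move=> [[a x] b]; rewrite /K /neg_triple /=; ring.
Qed.

(** Substitute [4 a b = 4 M + 1 - x^2] in four times the cubic relation. *)
Lemma sum_triples_dvd5 :
  (4 * M%:Z + 1) * \sum_(t <- triples M) t.1.1 =
  5 * \sum_(t <- triples M) t.1.1 * (t.1.2 * t.1.2).
Proof.
apply/eqP; rewrite -subr_eq0 -oppr_eq0; apply/eqP.
transitivity
  (4 * \sum_(t <- triples M) t.1.1 * (t.1.2 * t.1.2 - t.1.1 * t.2)); last first.
  by rewrite sum_triples_cubic mulr0.
rewrite opprB !mulr_sumr -sumrB big_seq [RHS]big_seq; apply: eq_bigr.
case=> [[a x] b]; rewrite mem_triples => /and3P[_ _ /eqP <-] /=; ring.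
Qed.

End NonSquare.

(** * Parity classes of the triples for [M = 2 n] *)

Lemma triples_double_parity n a x b : (a, x, b) \in triples (2 * n) ->
  odd `|x| /\ ~~ (odd `|a| && odd `|b|).
Proof.
rewrite mem_triples => /and3P[a0 b0 /eqP e].
have [k [xE|xE]] : exists k : int, x = 2 * k \/ x = 2 * k + 1.
  by exists (x %/ 2)%Z; lia.
  by exfalso; move: e; rewrite xE; lia.
split; first lia.
apply/negP => /andP[oa ob].
have [c aE] : exists c : int, a = 2 * c + 1 by exists (a %/ 2)%Z; lia.
have [d bE] : exists d : int, b = 2 * d + 1 by exists (b %/ 2)%Z; lia.
(* Since [k (k + 1)] is even, [x^2] is 1 modulo 8, so [a b] is even. *)
have [l [kE|kE]] : exists l : int, k = 2 * l \/ k = 2 * l + 1.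
  by exists (k %/ 2)%Z; lia.
- by move: e; rewrite xE aE bE kE; lia.
- by move: e; rewrite xE aE bE kE; lia.
Qed.

Lemma sum_triples_parity n :
  (forall s : int, s * s <> 4 * (2 * n)%N%:Z + 1) ->
  \sum_(t <- triples (2 * n))
     (if odd `|t.1.1| then t.1.1 else if odd `|t.2| then 0 else - t.1.1) = 0.
Proof.
move=> nonsq.
pose G (t : triple) : int :=
  if odd `|t.1.1| then t.1.1 else if odd `|t.2| then 0 else - t.1.1.
pose K (t : triple) : int :=
  if odd `|t.1.1| then t.1.2 else if odd `|t.2| then - t.1.2 else 0.
have : \sum_(t <- triples (2 * n)) (G t + G (swap_triple t) + K t) = 0.
  apply: (sum_zagier_odd nonsq) => a x b tS.
  have [ox oab] := triples_double_parity tS.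
  have := zagier_triples nonsq tS.
  rewrite mem_triples in tS; move/and3P: tS => [a0 b0 _].
  rewrite /zagier /G /K /swap_triple.
  (* The first branch preserves the class [a] odd, the second the class [b] odd; each exchanges the
     other two of the three classes. *)
  by case: ifP => _ /triples_double_parity[ox' oab'] /=; do ?case: ifP => ?; lia.
rewrite !big_split /= sum_triples_swap (@sum_triples_odd _ K).
  by rewrite -/G; set z := \sum_(t <- _) _; lia.
by move=> [[a x] b]; rewrite /K /neg_triple /=; do ?case: ifP => _; lia.
Qed.

Lemma sum_pos_triples_dvd4 n :
  (forall s : int, s * s <> 4 * (2 * n)%N%:Z + 1) ->
  (4 %| \sum_(t <- pos_triples (2 * n)) (if odd `|t.2| then 0 else t.1.1))%Z.
Proof.
move=> nonsq.
pose D (t : triple) : int := if odd `|t.2| then 0 else t.1.1.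
pose H (t : triple) : int :=
  if odd `|t.1.1| || odd `|t.2| then 0 else (t.1.1 %/ 2)%Z.
(* Adding the vanishing sum of [sum_triples_parity] makes this termwise: for [a], [b] both even,
   [a = - a + 4 (a / 2)]. *)
have DH : \sum_(t <- triples (2 * n)) D t = 4 * \sum_(t <- triples (2 * n)) H t.
  rewrite mulr_sumr -[RHS]add0r -[X in X + _](sum_triples_parity nonsq) -big_split.
  rewrite big_seq [RHS]big_seq; apply: eq_bigr => -[[a x] b] /triples_double_parity.
  by rewrite /D /H /= => -[_]; do ?case: ifP => ? /=; lia.
rewrite !sum_triples_even // in DH.
apply/dvdzP; exists (\sum_(t <- pos_triples (2 * n)) H t); move: DH.
set u := \sum_(t <- _) D t; set v := \sum_(t <- _) H t.
by rewrite -[X in _ -> X = _]/u; lia.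
Qed.

(** * From triples back to divisor sums *)

Lemma sum_pos_triples M (F : triple -> int) :
  \sum_(t <- pos_triples M) F t =
  \sum_(0 <= j < M | (j * (j + 1) < M)%N)
    \sum_(d <- divisors (M - j * (j + 1)))
       F (d%:Z, (2 * j + 1)%N%:Z, ((M - j * (j + 1)) %/ d)%N%:Z).
Proof. by rewrite /pos_triples big_allpairs_dep big_filter /index_iota subn0. Qed.

Lemma sum_pos_triples_sigma M :
  \sum_(t <- pos_triples M) t.1.1 =
  (\sum_(0 <= j < M) sigma (M%:Z - (j * (j + 1))%N%:Z))%N%:Z.
Proof.
rewrite sum_pos_triples big_mkcond (big_morph Posz PoszD (erefl _)).
apply: eq_bigr => j _; rewrite /sigma subr_gt0 ltz_nat; case: ifP => // jM.
by rewrite subzn ?(ltnW jM) // (big_morph Posz PoszD (erefl _)).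
Qed.

(** The divisors of [2 m] with even cofactor are exactly the divisors of [m], here with
    [m = n - j (j + 1) / 2]. *)
Lemma sum_pos_triples_double_sigma n :
  \sum_(t <- pos_triples (2 * n)) (if odd `|t.2| then 0 else t.1.1) =
  (\sum_(0 <= j < 2 * n) sigma (n%:Z - ((j * (j + 1)) %/ 2)%N%:Z))%N%:Z.
Proof.
rewrite sum_pos_triples big_mkcond (big_morph Posz PoszD (erefl _)).
apply: eq_bigr => j _; rewrite /sigma subr_gt0 ltz_nat /=.
have jE : (j * (j + 1) = 2 * (j * (j + 1) %/ 2))%N.
  have : ~~ odd (j * (j + 1)) by rewrite oddM oddD /= addbT andbN.
  by lia.
move: (j * (j + 1) %/ 2)%N jE => T ->; rewrite ltn_mul2l /=.
case: ifP => // Tn; rewrite subzn ?(ltnW Tn) // (big_morph Posz PoszD (erefl _)).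
rewrite -mulnBr absz_nat; move: (n - T)%N (ltac:(lia) : (0 < n - T)%N) => m m0.
under eq_bigr do rewrite -if_neg.
rewrite -big_mkcond -big_filter; apply: perm_big; apply: uniq_perm.
- by rewrite filter_uniq ?divisors_uniq.
- exact: divisors_uniq.
move=> d; rewrite mem_filter -!dvdn_divisors ?muln_gt0 //.
apply/andP/idP => [[ev dm]|dm].
  apply/dvdnP; exists (2 * m %/ d %/ 2)%N.
  have := divnK dm; move: (2 * m %/ d)%N ev => q ev.
  by have [r ->] : exists r, q = (2 * r)%N; [exists (q %/ 2)%N; lia|rewrite mulKn //; lia].
by rewrite -muln_divA // oddM /= dvdn_mull.
Qed.

Local Close Scope ring_scope.

Theorem theorem1 (n : nat) (n_gt0 : 0 < n) :
  (~~ (5 %| n) ->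
     \big[addn/0]_(j \in [set: nat]%classic)
        sigma ((2 * n + 1)%:Z - (j * (j + 1))%:Z)%R = 0 %[mod 5])
  /\
  ((forall k : int, n%:Z%R <> ((k * (k + 1))%R %/ 2)%Z) ->
     \big[addn/0]_(j \in [set: nat]%classic)
        sigma (n%:Z - ((j * (j + 1)) %/ 2)%:Z)%R = 0 %[mod 4]).
Proof.
split=> hn.
  (* The truncation bound is [M], to match the range of [j] in [sum_pos_triples_sigma]. *)
  have [j|_ ->] :=
    @fsbig_sigma (2 * n + 1)%:Z%R (fun j => j * (j + 1)) (2 * n + 1); first nia.
  (* [8 n + 5] is 5 modulo 8, but odd squares are 1 modulo 8. *)
  have nonsq (s : int) : (s * s <> 4 * (2 * n + 1)%:Z + 1)%R.
    have [k [->|->]] : exists k : int, (s = 2 * k \/ s = 2 * k + 1)%R.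
      by exists (s %/ 2)%Z; lia.
      by lia.
    have [l [->|->]] : exists l : int, (k = 2 * l \/ k = 2 * l + 1)%R.
      by exists (k %/ 2)%Z; lia.
      by lia.
    by lia.
  have := sum_triples_dvd5 nonsq.
  rewrite sum_triples_even // sum_pos_triples_sigma.
  set A := (\sum_(0 <= j < _) _); set B := (\sum_(t <- _) _)%R => e.
  have : (5 %| (2 * (8 * n + 5)) * A)%N.
    suff : (5 %| ((2 * (8 * n + 5)) * A)%:Z)%Z by [].
    by apply/dvdzP; exists B; lia.
  (* [2 (8 n + 5)] is congruent to [n] modulo 5, hence prime to 5. *)
  rewrite Gauss_dvdr => [/eqP-> //|].
  by rewrite prime_coprime //; lia.
have [j jn|_ ->] := @fsbig_sigma n%:Z%R (fun j => j * (j + 1) %/ 2) (2 * n).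
  by rewrite lez_nat leq_divRL //; nia.
(* [8 n + 1 = (2 k + 1)^2] would make [n] the triangular number [k (k + 1) / 2]. *)
have nonsq (s : int) : (s * s <> 4 * (2 * n)%:Z + 1)%R.
  have [k [->|->]] : exists k : int, (s = 2 * k \/ s = 2 * k + 1)%R.
    by exists (s %/ 2)%Z; lia.
    by lia.
  by move=> e; apply: (hn k); lia.
have := sum_pos_triples_dvd4 nonsq.
by rewrite sum_pos_triples_double_sigma dvdzE => /eqP.
Qed.
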